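(* Let $d\ge1$. For every $\epsilon$ with $0<\epsilon<d+1$ there exists a job law $(\tau,B)$ (with $\tau\ge0$ and $B$ an a.s. finite non-empty random subset of $\mathbb{Z}^d$) such that $$\mathbb{E}\,\tau^{d+1-\epsilon}+\mathbb{E}\,(\operatorname{diam}B)^{d+1-\epsilon}<\infty$$ and such that, for every arrival rate $\lambda>0$, the (spatially homogeneous) Poisson hail system with arrival rate $\lambda$ and job law $(\tau,B)$ is unstable, i.e. not stable.
   Context: Notation: $|x|_\infty=\max_{1\le i\le d}|x_i|$ and $\operatorname{diam}B=\max_{x,y\in B}|x-y|_\infty$. Poisson hail system. For each site $w\in\mathbb{Z}^d$, independently over $w$, jobs (hailstones) arrive at $w$ at the points of a Poisson process of rate $\lambda$ on the time axis; a job arriving at $w$ carries a mark $(\tau,B'+w)$, where the pairs $(\tau,B')$ are i.i.d. copies of the job law $(\tau,B)$, independent of the arrival times. A job with mark $(\tau,A)$ requires $\tau$ units of simultaneous service from all servers (sites) in $A$. Let $W(t,x)$ be the workload at site $x$ at time $t$. If a job with mark $(\tau,A)$ arrives at time $t$, then $W(t,x)=\max_{y\in A}W(t-,y)+\tau$ for $x\in A$ and $W(t,x)=W(t-,x)$ for $x\notin A$; between arrivals of jobs whose set contains $x$, $W(\cdot,x)$ decreases linearly at rate $1$ until it reaches $0$, where it stays. Since infinitely many jobs arrive in every time interval, the workload is given precisely by the path representation: starting from full vacancy at time $0$, $W(t,x)=\sup_\gamma V(\gamma)\in[0,\infty]$, the supremum being over all piecewise constant cadlag paths $\gamma:[u,t]\to\mathbb{Z}^d$,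 $0\le u\le t$, with $\gamma(t)=x$ and such that whenever $\gamma(s)\ne\gamma(s-)$ a job arrives at time $s$ whose set contains both $\gamma(s)$ and $\gamma(s-)$; the score is $V(\gamma)=\sum_i\tau_i-(t-u)$, the sum being over all jobs $(\tau_i,A_i)$ arriving at times $s_i\in(u,t]$ with $\gamma(s_i)\in A_i$. Stable: starting from full vacancy at time $0$ (zero workload at every site), for each fixed $x\in\mathbb{Z}^d$ the family of distributions of $W(t,x)$, $t\ge 0$, is tight (as distributions on $[0,\infty)$). *)

(* Defs.v *)
From HB Require Import structures.
From mathcomp Require Import all_boot all_order all_algebra finmap.
From mathcomp Require Import all_classical all_reals all_analysis.

Set Implicit Arguments.
Unset Strict Implicit.
Unset Printing Implicit Defensive.

Import Order.TTheory GRing.Theory Num.Theory.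
Import numFieldNormedType.Exports.

Local Open Scope classical_set_scope.
Local Open Scope ring_scope.

Notation site d := 'rV[int]_d.

(* The pair (w, n) stands for the (n+1)-st job arriving at the site w. *)
Notation job d := (site d * nat)%type.

(* Finite subsets of Z^d, with the discrete sigma-algebra. *)
Definition stone (d : nat) : Type := {fset site d}.
HB.instance Definition _ d := Choice.on (stone d).
HB.instance Definition _ d := isPointed.Build (stone d) fset0%fset.
HB.instance Definition _ d := @isMeasurable.Build default_measure_display
  (stone d) discrete_measurable discrete_measurable0
  discrete_measurableC discrete_measurableU.

Definition linf_dist (d : nat) (x y : site d) : nat :=
  \max_(i < d) absz ((x - y)%R ord0 i).

Definition diam (d : nat) (B : stone d) : nat :=
  \max_(x <- enum_fset B) \max_(y <- enum_fset B) linf_dist x y.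

(* A law of (tau, B) is a probability on pairs (service time, finite set). *)
Definition job_law (R : realType) (d : nat)
    (law : probability (R * stone d)%type R) : Prop :=
  {ae law, forall z, 0 <= z.1 /\ z.2 <> fset0%fset}.

Section Workload.
Context (R : realType) (d : nat).

Variables (arrival tau : job d -> R) (zone : job d -> set (site d)).

(* The half-open intervals make gamma right continuous with left limits. *)
Definition piecewise_constant_cadlag (u t : R) (gamma : R -> site d) : Prop :=
  exists s : seq R,
    [/\ path <%R u s, last u s = t &
      forall i, (i < size s)%N -> forall r : R,
        nth 0 (u :: s) i <= r < nth 0 s i -> gamma r = gamma (nth 0 (u :: s) i)].

Definition left_limit (gamma : R -> site d) (s : R) (y : site d) : Prop :=
  \forall r \near s^'-, gamma r = y.

(* The values of gamma outside [u, t] are irrelevant. *)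
Definition admissible_path (t : R) (x : site d) (u : R) (gamma : R -> site d)
    : Prop :=
  [/\ 0 <= u <= t, piecewise_constant_cadlag u t gamma, gamma t = x &
    forall (s : R) (y : site d), u < s <= t ->
      left_limit gamma s y -> gamma s <> y ->
      exists j : job d, [/\ arrival j = s, zone j (gamma s) & zone j y]].

Definition jobs_met (t u : R) (gamma : R -> site d) : set (job d) :=
  [set j | u < arrival j <= t /\ zone j (gamma (arrival j))].

Definition score (t u : R) (gamma : R -> site d) : \bar R :=
  (\esum_(j in jobs_met t u gamma) (tau j)%:E - (t - u)%:E)%E.

Definition path_workload (t : R) (x : site d) : \bar R :=
  ereal_sup [set v | exists u gamma,
    admissible_path t x u gamma /\ v = score t u gamma].

End Workload.

Definition mutually_independent (R : realType) (d1 d2 : measure_display)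
    (Omega : measurableType d1) (T : measurableType d2)
    (P : probability Omega R) (I : choiceType) (X : I -> Omega -> T) : Prop :=
  forall (F : {fset I}) (A : I -> set T), (forall i, measurable (A i)) ->
    P (\bigcap_(i in [set` F]) (X i @^-1` A i))
    = (\prod_(i <- enum_fset F) P (X i @^-1` A i))%E.

(* The arrival times at a site are the partial sums of its gaps, and mark j is
   (tau, B'), the set of the job being B' translated by the site of arrival. *)
Record poisson_hail (R : realType) (d : nat) (disp : measure_display)
    (Omega : measurableType disp) (P : probability Omega R)
    (lambda : R) (law : probability (R * stone d)%type R) := PoissonHail {
  gap : job d -> {RV P >-> R} ;
  mark : job d -> {RV P >-> (R * stone d)%type} ;
  gap_markE : forall (j : job d) (A : set R) (C : set (R * stone d)%type),
    measurable A -> measurable C ->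
    P (gap j @^-1` A `&` mark j @^-1` C) = (exponential_prob lambda A * law C)%E ;
  gap_mark_independent :
    mutually_independent P (fun j omega => (gap j omega, mark j omega))
}.

Section PoissonHail.
Context (R : realType) (d : nat) (disp : measure_display)
  (Omega : measurableType disp) (P : probability Omega R)
  (lambda : R) (law : probability (R * stone d)%type R)
  (H : poisson_hail P lambda law).

Definition arrival_time (omega : Omega) (j : job d) : R :=
  \sum_(k < j.2.+1) gap H (j.1, k : nat) omega.

Definition service_time (omega : Omega) (j : job d) : R := (mark H j omega).1.

Definition job_zone (omega : Omega) (j : job d) : set (site d) :=
  [set x | x - j.1 \in (mark H j omega).2].

Definition workload (t : R) (x : site d) (omega : Omega) : \bar R :=
  path_workload (arrival_time omega) (service_time omega) (job_zone omega) t x.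

(* Tightness of the laws of W(t, x), t >= 0. The outer measure of P agrees with
   P on measurable events, and spares a proof that W(t, x) is measurable. *)
Definition stable : Prop :=
  forall (x : site d) (e : R), 0 < e ->
  exists K : R, forall t : R, 0 <= t ->
    (mu_ext P [set omega | K%:E < workload t x omega] <= e%:E)%E.

End PoissonHail.

(* Main.v *)
(** The law charges, for l = 2^k, the job with service time l^m and set the cube
    [0, l^m)^d, with probability of order l^-s, where s = m(d+1) - 3 and m is so
    large that m eps >= 4: the moments of order d+1-eps are then dominated by the
    sum of l^(-s + m(d+1-eps)) <= l^-1 over the powers l of 2.

    There are l^(md) sites whose job of size l^m would cover the origin. Consider
    the first l^(m-2) jobs at each of them, l^(s+1) jobs in all. With high
    probability every gap is at most l, so that all these jobs arrive by time
    t = l^(m-1), and one of them has size l^m. The path staying at the origin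
    during [0, t] then scores at least l^m - l^(m-1), which is arbitrarily large.
    A union bound handles the gaps, so that independence is only used for the
    event that no mark is of size l^m. *)
Require Import Defs.
From HB Require Import structures.
From mathcomp Require Import all_boot all_order all_algebra finmap.
From mathcomp Require Import all_classical all_reals all_analysis.
From mathcomp Require Import measurable_realfun ring lra zify.

Set Implicit Arguments.
Unset Strict Implicit.
Unset Printing Implicit Defensive.

Import Order.TTheory GRing.Theory Num.Theory.
Import numFieldNormedType.Exports.

Local Open Scope classical_set_scope.
Local Open Scope ring_scope.

(** * Geometric series and laws with countably many atoms *)

Lemma eseries_geometric (R : realType) (a r : R) : 0 <= r < 1 ->
  (\sum_(k <oo) (a * r ^+ k)%:E = (a / (1 - r))%:E)%E.
Proof.
move=> /andP[r0 r1]; apply: cvg_lim => //; apply: cvg_EFin.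
  by apply: nearW => n; rewrite sumEFin.
rewrite [X in X @ _ --> _](_ : _ = series (geometric a r)); last first.
  by apply/funext => n /=; rewrite sumEFin.
by apply: cvg_geometric_series; rewrite ger0_norm.
Qed.

(** The law is a countable sum of weighted Dirac masses, so integrals against it are series; this
    reduces the moments of the job law to a comparison of series. *)
Lemma discrete_law_exists (R : realType) (disp : measure_display)
    (T : measurableType disp) (w : nat -> R) (z : nat -> T) :
  (forall k, 0 <= w k) -> (\sum_(k <oo) (w k)%:E = 1)%E ->
  exists law : probability T R,
    (forall A, law A = \sum_(k <oo) (w k)%:E * \d_(z k) A)%E /\
    forall f : T -> \bar R, measurable_fun setT f ->
      (forall x, 0 <= f x)%E ->
      (\int[law]_x f x = \sum_(k <oo) (w k)%:E * f (z k))%E.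
Proof.
move=> w0 w1; pose nu := mseries (fun k => mscale (NngNum (w0 k)) (\d_(z k))) 0.
have nuT : nu setT = 1%E.
  rewrite -w1; apply: eq_eseriesr => k _.
  by rewrite [LHS]/=/mscale/= diracT mule1.
pose law := HB.pack_for (probability T R) nu
  (Measure_isProbability.Build _ _ _ nu nuT).
exists law; split=> // f mf f0.
rewrite [LHS](@ge0_integral_measure_series _ _ _ _ setT)//.
apply: eq_eseriesr => k _; rewrite ge0_integral_mscale//.
by rewrite integral_dirac// diracT mul1e.
Qed.

(** * Cubes, and the workload caused by a single job *)

Definition cube (d L : nat) : stone d :=
  [fset \row_i (f i : nat)%:Z
    | f : {ffun 'I_d -> 'I_L} in {: {ffun 'I_d -> 'I_L}}]%fset.

Lemma card_cube (d L : nat) : #|` cube d L| = (L ^ d)%N.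
Proof.
rewrite card_imfset/=; last first.
  by move=> f g /rowP e; apply/ffunP => i; apply/val_inj; have := e i;
    rewrite !mxE => -[].
by rewrite -cardE card_ffun !card_ord.
Qed.

Lemma cube_neq0 (d L : nat) : (0 < L)%N -> cube d L <> fset0%fset.
Proof.
by move=> L0; apply/eqP; rewrite -cardfs_gt0 card_cube expn_gt0 L0.
Qed.

Lemma diam_cube (d L : nat) : (diam (cube d L) <= L)%N.
Proof.
rewrite /diam big_seq; apply/bigmax_leqP_seq => x _ /imfsetP[/= f _ ->].
rewrite big_seq; apply/bigmax_leqP_seq => y _ /imfsetP[/= g _ ->].
apply/bigmax_leqP => i _; rewrite !mxE.
by have := ltn_ord (f i); have := ltn_ord (g i); lia.
Qed.

(** The path that stays at [x] during [[0, t]] meets [j] and pays the full duration [t]. *)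
Lemma single_job_workload (R : realType) (d : nat) (arrival tau : job d -> R)
    (zone : job d -> set (site d)) (t : R) (x : site d) (j : job d) :
  0 < arrival j <= t -> zone j x ->
  ((tau j - t)%:E <= path_workload arrival tau zone t x)%E.
Proof.
move=> /andP[aj0 ajt] zjx; have t0 : 0 < t by exact: lt_le_trans ajt.
apply: (@le_trans _ _ (score arrival tau zone t 0 (cst x))); last first.
  apply: ereal_sup_ubound; exists 0, (cst x); split => //; split => //.
  - by rewrite lexx ltW.
  - by exists [:: t]; split => //=; rewrite t0.
  (* A constant path never jumps: left neighbourhoods of [s] are nonempty, so its left limit can
     only be [x]. *)
  - move=> s y _ lim_s; suff [r ->] : exists r : R, x = y by [].
    exact: (@filter_ex _ (at_left s) _ (fun=> x = y) lim_s).
rewrite /score subr0 EFinB leeD2r//; apply: esum_ge.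
(* [esum] is a supremum over finite subsets, so the singleton already bounds it from below. *)
exists [set j]; last by rewrite fsbig_set1.
by split; [exact: finite_set1|move=> _ ->; split; first exact/andP].
Qed.

(** * Probability that a gap is too long or that no large job comes *)

Section missed_job.
Context (R : realType) (d : nat) (disp : measure_display)
  (Omega : measurableType disp) (P : probability Omega R)
  (lambda : R) (law : probability (R * stone d)%type R)
  (H : poisson_hail P lambda law).
Hypothesis lambda_gt0 : 0 < lambda.

(** The complement also contains the nonpositive reals, which are null for the exponential law. One
    event thus controls both the length and the strict positivity of a gap. *)
Lemma gap_tail (j : job d) (a : R) : 0 < a ->
  P (gap H j @^-1` (~` `]0, a])) = (expR (- lambda * a))%:E.
Proof.
move=> a0; pose I := [set` `]0, a]] : set R.
have mI : measurable (gap H j @^-1` I).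
  by apply: (measurable_funPTI (gap H j)); exact: measurable_itv.
transitivity (1 - P (gap H j @^-1` I))%E; first exact: probability_setC.
have := @gap_markE _ _ _ _ _ _ _ H j I setT (measurable_itv _) measurableT.
rewrite preimage_setT setIT probability_setT mule1 => ->.
rewrite /exponential_prob integral_itv_obnd_cbnd; last first.
  by apply/measurable_EFinP/measurable_funTS; exact: measurable_exponential_pdf.
rewrite -/(exponential_prob _ _) exponential_prob_itv0c// oppeB//=.
by rewrite addeA subee// add0e.
Qed.

Lemma mark_law (j : job d) (C : set (R * stone d)) : measurable C ->
  P (mark H j @^-1` C) = law C.
Proof.
move=> mC; have := @gap_markE _ _ _ _ _ _ _ H j setT C measurableT mC.
rewrite preimage_setT setTI => ->.
by rewrite /exponential_prob integral_exponential_pdf// mul1e.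
Qed.

(** Independence is given for the pairs (gap, mark); rectangles [setT] times [C] transfer it to the
    marks. *)
Lemma all_marks_prob (F : {fset job d}) (C : set (R * stone d)) : measurable C ->
  P (\bigcap_(j in [set` F]) (mark H j @^-1` C)) = (law C ^+ #|` F|)%E.
Proof.
move=> mC; have := @gap_mark_independent _ _ _ _ _ _ _ H F
  (fun=> setT `*` C) (fun=> measurableX measurableT mC).
rewrite (_ : \bigcap_(_ in _) _ =
    \bigcap_(j in [set` F]) (mark H j @^-1` C)); last first.
  by apply: eq_bigcapr => j _; apply/seteqP; split => w /=; [case|split].
move=> ->; under eq_bigr => j _.
  rewrite (_ : _ @^-1` _ = mark H j @^-1` C); last first.
    by apply/seteqP; split => w /=; [case|split].
  rewrite mark_law//.
  over.
by rewrite big_const_seq count_predT; elim: #|` F| => // n; rewrite iterS expeS => ->.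
Qed.

Lemma missed_job_prob (F : {fset job d}) (C : set (R * stone d)) (a p : R) :
  measurable C -> 0 < a -> 0 <= p <= 1 -> (p%:E <= law C)%E ->
  (P (\bigcup_(j in [set` F]) (gap H j @^-1` (~` `]0%R, a])) `|`
      \bigcap_(j in [set` F]) (mark H j @^-1` (~` C)))
   <= (#|` F|%:R * expR (- lambda * a) + (1 - p) ^+ #|` F|)%:E)%E.
Proof.
move=> mC a0 /andP[p0 p1] pC.
have mgap j : measurable (gap H j @^-1` (~` `]0, a])).
  by apply: (measurable_funPTI (gap H j)); exact: measurableC.
have mmark j : measurable (mark H j @^-1` (~` C)).
  by apply: (measurable_funPTI (mark H j)); exact: measurableC.
have mU : measurable (\bigcup_(j in [set` F]) (gap H j @^-1` (~` `]0, a]))).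
  by apply: fin_bigcup_measurable => //; exact: finite_fset.
have mI : measurable (\bigcap_(j in [set` F]) (mark H j @^-1` (~` C))).
  by apply: fin_bigcap_measurable => //; exact: finite_fset.
rewrite EFinD; apply: le_trans; first exact: measureU2; apply: leeD.
  apply: le_trans.
    by apply: content_sub_fsum (@subset_refl _ _) => //; exact: finite_fset.
  rewrite -fsbig_seq//= (eq_bigr (fun=> (expR (- lambda * a))%:E)); last first.
    by move=> j _; rewrite gap_tail.
  by rewrite sumEFin big_const_seq count_predT iter_addr_0 mulr_natl.
rewrite [leLHS]all_marks_prob; last exact: measurableC.
have mC' : measurable (~` C) by exact: measurableC.
have lawC : law (~` C) \is a fin_num by exact: fin_num_measure.
have lawC_le : (law (~` C) <= (1 - p)%:E)%E.
  by rewrite probability_setC// EFinB leeB.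
rewrite -(fineK lawC) -EFin_expe lee_fin lerXn2r ?nnegrE ?fine_ge0 ?subr_ge0//.
by rewrite -lee_fin fineK.
Qed.

End missed_job.
(** Both terms are O(1/l). One term of the exponential series gives exp(-lambda l) <= (s+2)!/(lambda
    l)^(s+2), so the first is at most c/l. By 1 - p <= exp(-p), the second is at most exp(-l/2) <=
    2/l. *)
Lemma missed_job_bound_small (R : realType) (lambda e : R) (s : nat) :
  0 < lambda -> 0 < e -> exists X : R, forall l : nat, X <= l%:R ->
    (l ^ s.+1)%N%:R * expR (- lambda * l%:R)
      + (1 - (2 * l ^ s)%N%:R^-1) ^+ (l ^ s.+1) <= e.
Proof.
move=> lambda0 e0; pose c : R := s.+2`!%:R / lambda ^+ s.+2.
have c0 : 0 < c by rewrite divr_gt0 ?exprn_gt0 ?ltr0n ?fact_gt0.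
exists (1 + (c + 2) / e) => l lX; have l0 : 0 < l%:R :> R.
  by apply: lt_le_trans lX; rewrite addr_gt0// divr_gt0//; lra.
have le0 : c + 2 <= l%:R * e by rewrite -ler_pdivrMr//; lra.
apply: (@le_trans _ _ ((c + 2) / l%:R)); last by rewrite ler_pdivrMr// mulrC.
rewrite mulrDl; apply: lerD.
  rewrite mulNr expRN -/(_ / _) ler_pdivrMr ?expR_gt0//.
  have := expR_ge1Dxn s.+1 (ltW (mulr_gt0 lambda0 l0)).
  move=> h; apply: (@le_trans _ _
    (c / l%:R * ((lambda * l%:R) ^+ s.+2 / s.+2`!%:R))).
    rewrite /c exprMn [l%:R ^+ s.+2]exprS natrX le_eqVlt; apply/orP; left; apply/eqP.
    field; apply/and3P.
    by split; apply: lt0r_neq0; [rewrite ltr0n fact_gt0| |exact: exprn_gt0].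
  apply: ler_wpM2l; first by rewrite divr_ge0// ltW.
  by apply: le_trans h; rewrite lerDr.
have ls0 : 0 < (l ^ s)%N%:R :> R by rewrite natrX exprn_gt0.
have pl0 : 0 < (2 * l ^ s)%N%:R :> R by rewrite natrM mulr_gt0.
set p := _^-1; have /andP[p0 p1] : 0 <= p <= 1.
  by rewrite invr_ge0 ler0n /= invf_le1// ler1n -(ltr0n R).
apply: (@le_trans _ _ (expR (- p) ^+ (l ^ s.+1))).
  by rewrite lerXn2r ?nnegrE ?expR_ge0 ?expR_ge1Dx//; lra.
rewrite -expRM_natr mulNr expRN -[leRHS]invf_div lef_pV2 ?posrE ?expR_gt0 ?divr_gt0//.
have -> : p * (l ^ s.+1)%N%:R = l%:R / 2.
  by rewrite /p expnSr !natrM; field; rewrite gt_eqF.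
by have := expR_ge1Dx (l%:R / 2 : R); lra.
Qed.

(** * The heavy-tailed job law *)

Lemma heavy_law_exists (R : realType) (d m : nat) (eps : R) :
  0 < eps < d.+1%:R -> (4 <= m)%N -> 4 <= m%:R * eps ->
  exists law : probability (R * stone d)%type R,
    [/\ job_law law,
        ('E_law[fun z => (z.1 `^ (d.+1%:R - eps))%R]
          + 'E_law[fun z => ((diam z.2)%:R `^ (d.+1%:R - eps))%R] < +oo)%E &
        forall k (A : set (R * stone d)),
          A (((2 ^ k) ^ m)%N%:R, cube d ((2 ^ k) ^ m)) ->
          (((2 ^ (k * (m * d.+1 - 3)).+1)%N%:R^-1)%:E <= law A)%E].
Proof.
move=> /andP[eps0 epsd] m4 meps; set q := d.+1%:R - eps.
have q0 : 0 <= q by rewrite subr_ge0 ltW.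
pose s := (m * d.+1 - 3)%N.
have s0 : (0 < s)%N by rewrite /s; nia.
pose r : R := (2 ^ s)%N%:R^-1.
have r0 : 0 <= r by rewrite invr_ge0.
(* This makes the normalising factor 1 - r at least 1/2, whence the additional factor 2 in the lower
   bound on the atoms. *)
have r12 : r <= 2^-1.
  rewrite lef_pV2 ?posrE ?ltr0n ?expn_gt0// ler_nat.
  by rewrite -[X in (X <= _)%N]expn1 leq_exp2l.
pose w k := (1 - r) * r ^+ k.
pose z k : R * stone d := (((2 ^ k) ^ m)%N%:R, cube d ((2 ^ k) ^ m)).
have w0 k : 0 <= w k by rewrite mulr_ge0 ?exprn_ge0//; lra.
have w1 : (\sum_(k <oo) (w k)%:E = 1)%E.
  by rewrite eseries_geometric ?divff//; lra.
have [law [lawE lawI]] := discrete_law_exists z w0 w1.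
(* With q = d+1-eps the exponent of 2 is at most k(-s + mq) = k(3 - m eps) <= -k. *)
have wL k : w k * ((2 ^ k) ^ m)%N%:R `^ q <= 1 * (2^-1) ^+ k.
  have -> : 1 * (2^-1) ^+ k = 2 `^ (- k%:R) :> R.
    by rewrite mul1r powRN powR_mulrn// exprVn.
  have -> : ((2 ^ k) ^ m)%N%:R `^ q = 2 `^ (k%:R * m%:R * q) :> R.
    by rewrite -expnM natrX -powR_mulrn// -powRrM natrM.
  apply: (@le_trans _ _ (2 `^ (- (k%:R * s%:R)) * 2 `^ (k%:R * m%:R * q))).
    apply: ler_wpM2r; first exact: powR_ge0.
    have -> : 2 `^ (- (k%:R * s%:R)) = r ^+ k :> R.
      by rewrite powRN -natrM powR_mulrn// /r natrX exprVn -exprM mulnC.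
    by rewrite -[leRHS]mul1r /w ler_wpM2r ?exprn_ge0//; lra.
  rewrite -powRD ?pnatr_eq0 ?implybT//.
  apply: ler_powR; first lra.
  have -> : s%:R = m%:R * d.+1%:R - 3 :> R.
    by rewrite /s natrB ?natrM//; nia.
  rewrite /q -[X in _ <= X]mulrN1 mulrBr.
  have k0 : 0 <= k%:R :> R by [].
  have := ler_wpM2l k0 meps; lra.
have E_lty (f : R * stone d -> R) : measurable_fun setT f ->
    (forall x, 0 <= f x) -> (forall k, f (z k) <= ((2 ^ k) ^ m)%N%:R `^ q) ->
    ('E_law[f] < +oo)%E.
  move=> mf f0 fz; rewrite unlock lawI; last 2 first.
  - exact/measurable_EFinP.
  - by move=> x; rewrite lee_fin.
  apply: (@le_lt_trans _ _ (\sum_(k <oo) (1 * (2^-1) ^+ k)%:E)%E).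
    apply: lee_nneseries => [k _ _|k _].
      by rewrite -EFinM lee_fin mulr_ge0.
    by rewrite -EFinM lee_fin; apply: le_trans (wL k); exact: ler_wpM2l.
  by rewrite eseries_geometric ?ltry//; lra.
exists law; split.
- exists [set x : R * stone d | ~ (0 <= x.1 /\ x.2 <> fset0%fset)]; split => //.
  + rewrite (_ : mkset _ = ~` (`[0, +oo[ `*` ~` [set fset0%fset])); last first.
      by apply/seteqP; split => x /= h h'; apply: h; move: h' => [];
        rewrite in_itv/= andbT.
    by apply: measurableC; apply: measurableX.
  + rewrite lawE eseries0// => k _ _; rewrite diracE memNset ?mule0//= /z.
    by apply; split => //; apply: cube_neq0; rewrite !expn_gt0.
- apply: lte_add_pinfty; apply: E_lty.
  + by apply: (measurableT_comp (measurable_powR q)); exact: measurable_fst.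
  + by move=> x; exact: powR_ge0.
  + by [].
  + have mdiam : measurable_fun [set: stone d]
        (fun B => (diam B)%:R `^ q : R) by [].
    exact: (measurableT_comp mdiam measurable_snd).
  + by move=> x; exact: powR_ge0.
  + by move=> k; apply: ge0_ler_powR => //; rewrite ?nnegrE// ler_nat diam_cube.
(* The series dominates its partial sum through index k, whose last term is the mass of the atom
   [z k]. *)
- move=> k A Az; rewrite lawE.
  apply: le_trans (@nneseries_lim_ge _ _ _ _ k.+1 _); last first.
    by move=> n _ _; rewrite mule_ge0// lee_fin.
  rewrite big_nat_recr//= diracE mem_set// mule1.
  apply: (@le_trans _ _ (w k)%:E); last first.
    by rewrite leeDr//; apply: sume_ge0 => n _; rewrite mule_ge0// lee_fin.
  rewrite lee_fin /w expnS natrM invfM; apply: ler_pM => //; first lra.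
  by rewrite /r exprVn -natrX -expnM mulnC.
Qed.

(** * Jobs that can reach the origin, and instability *)

Lemma exists_large_pow2 (R : realType) (x : R) : exists k : nat, x <= (2 ^ k)%N%:R.
Proof.
exists (Num.bound `|x|); apply: le_trans (ler_norm _) _.
apply: le_trans (ltW (archi_boundP (normr_ge0 x))) _.
by rewrite ler_nat; apply: ltnW; exact: ltn_expl.
Qed.

(** A cube translated by [w] covers the origin exactly when [- w] lies in the cube, hence the
    sign. *)
Definition jobs_near_origin (d L N : nat) : {fset job d} :=
  [fset j in [seq (- x, n) | x <- enum_fset (cube d L), n <- iota 0 N]]%fset.

Lemma card_jobs_near_origin (d L N : nat) :
  #|` jobs_near_origin d L N| = (L ^ d * N)%N.
Proof.
rewrite /jobs_near_origin card_fseq undup_id.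
  by rewrite size_allpairs size_iota -card_cube.
apply: allpairs_uniq; [exact: fset_uniq|exact: iota_uniq|].
by move=> [x n] [y p] _ _ /= [/oppr_inj-> ->].
Qed.

Lemma mem_jobs_near_origin (d L N : nat) (w : site d) (n : nat) :
  (w, n) \in jobs_near_origin d L N = (- w \in cube d L) && (n < N)%N.
Proof.
rewrite inE /=; apply/allpairsP/andP => [[[x p] /= [xL pN [-> ->]]]|[wL nN]].
  by rewrite opprK; move: pN; rewrite mem_iota.
by exists (- w, n); rewrite /= opprK mem_iota.
Qed.

(** The difference is l^(m-1) (l - 1), with l^(m-1) >= 1 and l - 1 > K. The maximum with 0 covers
    negative [K]. *)
Lemma pow_gap (R : realType) (K : R) (l m : nat) :
  (2 <= m)%N -> Num.max 0 K + 2 <= l%:R ->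
  K < (l ^ m)%N%:R - (l ^ (m - 2))%N%:R * l%:R.
Proof.
case: m => [|[|m]]// _; rewrite subn2 /= => Kl.
have K0 : K <= Num.max 0 K by rewrite le_max lexx orbT.
have M0 : 0 <= Num.max 0 K by rewrite le_max lexx.
have l1 : 1 <= (l ^ m.+1)%N%:R :> R.
  by rewrite ler1n expn_gt0 -(ltr0n R); apply/orP; left; lra.
by rewrite -natrM -expnSr expnS natrM; nra.
Qed.

Theorem theorem2 (R : realType) (d : nat) (hd : (1 <= d)%N)
    (eps : R) (heps : 0 < eps < d.+1%:R) :
  exists law : probability (R * stone d)%type R,
    [/\ job_law law,
        ('E_law[fun z => (z.1 `^ (d.+1%:R - eps))%R]
          + 'E_law[fun z => ((diam z.2)%:R `^ (d.+1%:R - eps))%R] < +oo)%E &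
        forall lambda : R, 0 < lambda ->
        forall (disp : measure_display) (Omega : measurableType disp)
          (P : probability Omega R) (H : poisson_hail P lambda law),
          ~ stable H].
Proof.
have eps0 : 0 < eps by case/andP: heps.
have [m [m4 meps]] : exists m, (4 <= m)%N /\ 4 <= m%:R * eps.
  exists (4 + Num.bound (4 / eps))%N; rewrite leq_addr -ler_pdivrMr// natrD.
  split=> //; apply: ltW; apply: lt_le_trans (archi_boundP _) _.
    by rewrite divr_ge0// ltW.
  by rewrite lerDr.
have [law [lawP lawE lawz]] := heavy_law_exists heps m4 meps.
exists law; split => // lambda lambda0 disp Omega P H st.
(* Tightness is tested at level 1/2, while the bad event will have probability at most 1/4, so the
   workload exceeds [K] with probability at least 3/4. *)
have e0 : 0 < 4^-1 :> R by rewrite invr_gt0.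
have [K stK] := st 0 (2^-1) ltac:(by rewrite invr_gt0).
pose s := (m * d.+1 - 3)%N.
have [X XP] := @missed_job_bound_small R lambda _ s lambda0 e0.
have [k] := exists_large_pow2 (Num.max X (Num.max 0 K + 2)).
set l := (2 ^ k)%N; rewrite ge_max => /andP[Xl Kl].
pose L := (l ^ m)%N; pose N := (l ^ (m - 2))%N.
have l0 : (0 < l)%N by rewrite expn_gt0.
pose F := jobs_near_origin d L N.
(* The exponents match: md + (m - 2) = m(d+1) - 2 = s + 1. *)
have cardF : #|` F| = (l ^ s.+1)%N.
  rewrite card_jobs_near_origin -expnM -expnD; congr (l ^ _)%N.
  by rewrite /s; nia.
pose C : set (R * stone d) := [set L%:R] `*` [set cube d L].
have mC : measurable C by apply: measurableX.
pose p : R := (2 * l ^ s)%N%:R^-1.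
have pC : (p%:E <= law C)%E.
  by rewrite /p /l -expnM -expnS; exact: lawz.
have p01 : 0 <= p <= 1.
  by rewrite invr_ge0 ler0n /= invf_le1 ?ler1n ?ltr0n muln_gt0 expn_gt0 l0.
pose Bad := \bigcup_(j in [set` F]) (gap H j @^-1` (~` `]0, l%:R])) `|`
  \bigcap_(j in [set` F]) (mark H j @^-1` (~` C)).
have mBad : measurable Bad.
  apply: measurableU.
    apply: fin_bigcup_measurable; first exact: finite_fset.
    move=> j _; apply: (measurable_funPTI (gap H j)).
    by apply: measurableC; exact: measurable_itv.
  apply: fin_bigcap_measurable; first exact: finite_fset.
  by move=> j _; apply: (measurable_funPTI (mark H j)); exact: measurableC.
have PBad : (P Bad <= (4^-1)%:E)%E.
  apply: le_trans (missed_job_prob H lambda0 F mC _ p01 pC) _; first by rewrite ltr0n.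
  by rewrite lee_fin cardF; exact: XP.
(* The bound [K] is uniform in time, so [t] may depend on it through [l]. *)
pose t : R := N%:R * l%:R.
have t0 : 0 <= t by rewrite mulr_ge0.
have LtK : K < L%:R - t by apply: pow_gap => //; exact: ltnW (ltnW m4).
have good : ~` Bad `<=` [set omega | K%:E < workload H t 0 omega]%E.
  move=> omega /not_orP[ngap nmark] /=.
  have gapP w n : (- w \in cube d L) -> (n < N)%N ->
      0 < gap H (w, n) omega <= l%:R.
    move=> wL nN; apply: contrapT => h; apply: ngap; exists (w, n) => /=.
      by rewrite mem_jobs_near_origin wL.
    by rewrite in_itv.
  have [[w n] /= jF markC] : exists2 j, j \in F & C (mark H j omega).
    by apply: contrapT => h; apply: nmark => j jF jC; apply: h; exists j.
  move: jF; rewrite mem_jobs_near_origin => /andP[wL nN].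
  apply: lt_le_trans; last apply: (@single_job_workload _ _ _ _ _ _ _ (w, n)).
  - by rewrite lte_fin /service_time markC.1.
  (* The arrival time is a sum of n+1 <= N gaps: positive since each gap is, and at most N l = t. *)
  - apply/andP; split.
      rewrite /arrival_time big_ord_recr /= ltr_wpDl//.
        apply: sumr_ge0 => i _; apply/ltW.
        by case/andP: (gapP w i wL (ltn_trans (ltn_ord i) nN)).
      by case/andP: (gapP w n wL nN).
    apply: (@le_trans _ _ (\sum_(i < n.+1) l%:R)).
      apply: ler_sum => i _.
      by case/andP: (gapP w i wL (leq_trans (ltn_ord i) nN)).
    rewrite sumr_const card_ord -[leLHS]mulr_natl.
    by apply: ler_wpM2r => //; rewrite ler_nat.
  - by rewrite /job_zone /= sub0r markC.2.
have := stK t t0; apply/negP; rewrite -ltNge.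
apply: lt_le_trans (le_mu_ext P good).
have -> : mu_ext P (~` Bad) = (1 - P Bad)%E.
  transitivity (P (~` Bad)); last exact: probability_setC.
  by apply: measurable_mu_extE; exact: measurableC.
have fB : P Bad \is a fin_num by exact: fin_num_measure.
rewrite -(fineK fB) -EFinB lte_fin; move: PBad.
by rewrite -{1}(fineK fB) lee_fin; lra.
Qed.
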